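(* There exists a universal constant $C>0$ such that the following holds; moreover one may take $C=24$. For every integer $n\ge 1$, every integer $0\le k\le n$, and every $z=(z_1,\dots,z_n)\in\mathbb{C}^n$ with $\sum_{i=1}^n z_i=0$ and $\sum_{i=1}^n |z_i|^2=n$, $$|e_k(z)|\le \sqrt{C\binom{n}{k}}.$$
   Context: For $z\in\mathbb{C}^n$ and $0\le k\le n$, the elementary symmetric polynomial of degree $k$ is $e_k(z)=\sum_{S\subseteq\{1,\dots,n\},\,|S|=k}\ \prod_{i\in S}z_i$ (so $e_0(z)=1$). ''Universal constant'' means independent of $n$, $k$ and $z$. *)

(* Defs.v *)
From mathcomp Require Import all_boot all_order all_algebra.
From mathcomp Require Import reals complex.

Set Implicit Arguments.
Unset Strict Implicit.
Unset Printing Implicit Defensive.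

Import Order.TTheory GRing.Theory Num.Theory.

Local Open Scope ring_scope.
Local Open Scope complex_scope.

Definition elem_sym (A : comNzRingType) (n : nat) (z : 'I_n -> A) (k : nat) : A :=
  \sum_(S : {set 'I_n} | #|S| == k) \prod_(i in S) z i.

(* The norm of R[i] takes its (real) values in R[i] itself, where x <= y means
   Im x = Im y and Re x <= Re y; real bounds are therefore embedded by %:C. *)
Definition elem_sym_bound (R : realType) (C : R) : Prop :=
  forall (n k : nat) (z : 'I_n -> R[i]),
    (1 <= n)%N -> (k <= n)%N ->
    \sum_(i < n) z i = 0 ->
    \sum_(i < n) `|z i| ^+ 2 = n%:R ->
    `|elem_sym z k| <= (Num.sqrt (C * 'C(n, k)%:R))%:C.

(* Main.v *)
Require Import Defs.
From mathcomp Require Import all_boot all_order all_algebra.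
From mathcomp Require Import reals complex.
From mathcomp Require Import sequences exp trigo.
From mathcomp Require Import zify ring lra.

(** Write P(t) for the product of the factors 1 + t z_i, so that e_k(z) is the
    coefficient of t^k in P.  For 0 < k < n take the circle |t| = r with
    r^2 = k/(n-k).  As the z_i sum to 0 and their squared moduli to n, the mean
    of |1 + t z_i|^2 over i is 1 + r^2 at every point of the circle, whence
    |P(t)| <= (1 + r^2)^(n/2) by the arithmetic-geometric mean inequality.
    Cauchy's estimate then gives |e_k|^2 <= H, where
    H = n^n / (k^k (n-k)^(n-k)).  With K = k(n-k)/n, the binomial coefficient
    is at least H / sqrt(8K) ([bin_entropy_lower]), so what remains is to gain
    a factor of order K^(1/4) in the mean of |P| over the circle, and only when
    K > 72, since sqrt(8 * 72) = 24.

    The gain comes from the loss in the arithmetic-geometric mean inequality.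
    With y_i = |1 + t z_i| / sqrt(1 + r^2) and D = sum (y_i - 1)^2, the product
    of the y_i is at most exp(-D/2) ([AGM_defect]).  The defect D cannot be
    small at three well separated points of the circle: there most y_i would be
    close to 1 at all three points, and comparing y_i^2 at two points u, v shows
    that Re ((u - v) z_i) would be small for two independent directions u - v.
    Then z_i is small for most i, against the normalisation.  Quantitatively, pairwise distances
    at least d <= 1 (on the unit circle) force the three defects to sum to at
    least 3 d^4 K / 64 ([three_point_defect], [defect_three_points]).  So the
    points where D <= d^4 K / 64 lie in two discs of radius d, which occupy at
    most a fraction 2d/3 of the circle ([card_small_defect]).

    The circle is replaced by the N-th roots of unity, N = 6M large, for which
    Cauchy's estimate is the orthogonality relation [elem_sym_fourier].  Put
    b^4 = 64/K.  Sorting the points by their defect turns the count above into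
    lower bounds for the successive values of D, and the mean of exp(-D/2) is
    at most b + 3/N ([sum_expR_defect]).  Since
    H <= sqrt(8K) C(n,k) = sqrt(512) C(n,k) / b^2 and sqrt(512) < 24, taking N
    large enough concludes.  For k = 0 and k = n the bound is direct. *)


Set Implicit Arguments.
Unset Strict Implicit.
Unset Printing Implicit Defensive.

Import Order.TTheory GRing.Theory Num.Theory.

Local Open Scope ring_scope.
Local Open Scope complex_scope.

Local Notation normc := ComplexField.Normc.normc.
Local Notation Re := complex.Re.
Local Notation Im := complex.Im.

(** * Unit triangles and projections *)

(** Four times the area S of a triangle with sides a, b, c and circumradius R
    is abc/R; here R = 1, and the cross product of two sides is 2S. *)
Lemma inscribed_triangle_cross (F : realFieldType) (u1 u2 v1 v2 w1 w2 : F) :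
  u1 ^+ 2 + u2 ^+ 2 = 1 -> v1 ^+ 2 + v2 ^+ 2 = 1 -> w1 ^+ 2 + w2 ^+ 2 = 1 ->
  4 * ((u1 - v1) * (v2 - w2) - (u2 - v2) * (v1 - w1)) ^+ 2 =
  ((u1 - v1) ^+ 2 + (u2 - v2) ^+ 2) * ((v1 - w1) ^+ 2 + (v2 - w2) ^+ 2) *
  ((w1 - u1) ^+ 2 + (w2 - u2) ^+ 2).
Proof.
move=> hu hv hw.
pose a := u1 * v1 + u2 * v2; pose b := u1 * w1 + u2 * w2.
pose c := v1 * w1 + v2 * w2.
pose p := u1 * v2 - u2 * v1; pose q := v1 * w2 - v2 * w1.
pose s := w1 * u2 - w2 * u1.
have chord (x1 x2 y1 y2 : F) : x1 ^+ 2 + x2 ^+ 2 = 1 -> y1 ^+ 2 + y2 ^+ 2 = 1 ->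
    (x1 - y1) ^+ 2 + (x2 - y2) ^+ 2 = 2 * (1 - (x1 * y1 + x2 * y2)).
  move=> hx hy.
  have -> : (x1 - y1) ^+ 2 + (x2 - y2) ^+ 2 = (x1 ^+ 2 + x2 ^+ 2) +
    (y1 ^+ 2 + y2 ^+ 2) - 2 * (x1 * y1 + x2 * y2) by ring.
  by rewrite hx hy; ring.
have lagrange (x1 x2 y1 y2 : F) : x1 ^+ 2 + x2 ^+ 2 = 1 ->
    y1 ^+ 2 + y2 ^+ 2 = 1 ->
    (x1 * y2 - x2 * y1) ^+ 2 = 1 - (x1 * y1 + x2 * y2) ^+ 2.
  move=> hx hy.
  have -> : (x1 * y2 - x2 * y1) ^+ 2 = (x1 ^+ 2 + x2 ^+ 2) *
    (y1 ^+ 2 + y2 ^+ 2) - (x1 * y1 + x2 * y2) ^+ 2 by ring.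
  by rewrite hx hy mul1r.
have binet (x1 x2 y1 y2 z1 z2 : F) : y1 ^+ 2 + y2 ^+ 2 = 1 ->
    (x1 * y2 - x2 * y1) * (y1 * z2 - y2 * z1) =
    (x1 * y1 + x2 * y2) * (y1 * z1 + y2 * z2) - (x1 * z1 + x2 * z2).
  move=> hy; rewrite -[x1 * z1 + x2 * z2]mulr1 -hy; ring.
have p2 : p ^+ 2 = 1 - a ^+ 2 by apply: lagrange.
have q2 : q ^+ 2 = 1 - c ^+ 2 by apply: lagrange.
have s2 : s ^+ 2 = 1 - b ^+ 2.
  by rewrite /s lagrange // /b; congr (_ - _); ring.
have pq : p * q = a * c - b by apply: binet.
have qs : q * s = c * b - a by rewrite /q /s binet // /c /b /a; ring.
have sp : s * p = b * a - c by rewrite /s /p binet // /c /b /a; ring.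
have gram : 1 + 2 * a * b * c - a ^+ 2 - b ^+ 2 - c ^+ 2 = 0.
  have : (p * q) ^+ 2 = p ^+ 2 * q ^+ 2 by ring.
  by rewrite pq p2 q2 => h; lra.
rewrite !chord // -/a -/c (_ : w1 * u1 + w2 * u2 = b); last by rewrite /b; ring.
have -> : (u1 - v1) * (v2 - w2) - (u2 - v2) * (v1 - w1) = p + q + s.
  by rewrite /p /q /s; ring.
have -> : (p + q + s) ^+ 2 = p ^+ 2 + q ^+ 2 + s ^+ 2
    + 2 * (p * q + q * s + s * p) by ring.
rewrite p2 q2 s2 pq qs sp.
lra.
Qed.

(** The sum of the squared projections of a vector on the sides of a triangle is
    a quadratic form M with trace T, the sum of the squared sides, and
    determinant 3 (2S)^2.  By Cayley-Hamilton T q(v) = |Mv|^2 + det M |v|^2, so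
    q(v) >= (det M / T) |v|^2; for an inscribed triangle the area formula
    expresses det M by the squared sides A, B, C, each at least d.
    The vector is (x, -y), which makes each projection the real part of a
    product of complex numbers. *)
Lemma triangle_projections (F : realFieldType)
    (u1 u2 v1 v2 w1 w2 x y d : F) :
  u1 ^+ 2 + u2 ^+ 2 = 1 -> v1 ^+ 2 + v2 ^+ 2 = 1 -> w1 ^+ 2 + w2 ^+ 2 = 1 ->
  0 <= d ->
  d <= (u1 - v1) ^+ 2 + (u2 - v2) ^+ 2 ->
  d <= (v1 - w1) ^+ 2 + (v2 - w2) ^+ 2 ->
  d <= (w1 - u1) ^+ 2 + (w2 - u2) ^+ 2 ->
  d ^+ 2 * (x ^+ 2 + y ^+ 2) <=
  4 * (((u1 - v1) * x - (u2 - v2) * y) ^+ 2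
     + ((v1 - w1) * x - (v2 - w2) * y) ^+ 2
     + ((w1 - u1) * x - (w2 - u2) * y) ^+ 2).
Proof.
move=> hu hv hw d0 hA hB hC.
have cr := @inscribed_triangle_cross F _ _ _ _ _ _ hu hv hw.
set A := (u1 - v1) ^+ 2 + _ in hA cr; set B := (v1 - w1) ^+ 2 + _ in hB cr.
set C := (w1 - u1) ^+ 2 + _ in hC cr.
set q := (X in _ <= 4 * X); set n := x ^+ 2 + y ^+ 2.
have n0 : 0 <= n by rewrite addr_ge0 ?sqr_ge0.
have q0 : 0 <= q by rewrite !addr_ge0 ?sqr_ge0.
have [dle|d_gt0] := leP d 0.
  have -> : d = 0 by apply/le_anti/andP.
  by rewrite expr0n mul0r mulr_ge0.
have T0 : 0 < A + B + C by lra.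
have key : (3 / 4) * (A * B * C) * n <= (A + B + C) * q.
  (* [m11], [m12], [m22] are the entries of the quadratic form M. *)
  pose m11 := (u1 - v1) ^+ 2 + (v1 - w1) ^+ 2 + (w1 - u1) ^+ 2.
  pose m22 := (u2 - v2) ^+ 2 + (v2 - w2) ^+ 2 + (w2 - u2) ^+ 2.
  pose m12 := (u1 - v1) * (u2 - v2) + (v1 - w1) * (v2 - w2)
    + (w1 - u1) * (w2 - u2).
  have -> : (A + B + C) * q = 3 / 4 * (A * B * C) * n +
     ((m11 * x - m12 * y) ^+ 2 + (m12 * x - m22 * y) ^+ 2).
    by rewrite -cr /A /B /C /q /n /m11 /m22 /m12; field.
  by rewrite lerDl addr_ge0 ?sqr_ge0.
have key4 : 3 * (A * B * C) * n <= (A + B + C) * (4 * q).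
  have -> : 3 * (A * B * C) * n = 4 * (3 / 4 * (A * B * C) * n) by field.
  by rewrite [leRHS]mulrCA ler_wpM2l.
rewrite -(ler_pM2l T0); apply: le_trans key4.
rewrite [leLHS]mulrA ler_wpM2r //.
have pr (a b : F) : d <= a -> d <= b -> d ^+ 2 <= a * b.
  by move=> ha hb; rewrite expr2 ler_pM.
have h1 : d ^+ 2 * C <= A * B * C by rewrite ler_wpM2r ?pr // (le_trans d0).
have h2 : d ^+ 2 * A <= A * B * C.
  by rewrite -mulrA mulrC ler_wpM2l ?pr // (le_trans d0).
have h3 : d ^+ 2 * B <= A * B * C.
  by rewrite [leRHS]mulrAC ler_wpM2r ?pr // (le_trans d0).
have -> : (A + B + C) * d ^+ 2 = d ^+ 2 * C + d ^+ 2 * A + d ^+ 2 * B by ring.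
by rewrite (_ : 3 * (A * B * C) = A * B * C + A * B * C + A * B * C) ?lerD //; ring.
Qed.

(** * The defect in the arithmetic-geometric mean inequality *)

Section Normc.
Variable R : realType.
Implicit Types z : R[i].

Lemma normcP z : `|z| = (normc z)%:C.
Proof. by case: z. Qed.

Lemma sqr_normcE z : normc z ^+ 2 = Re z ^+ 2 + Im z ^+ 2.
Proof. by case: z => a b /=; rewrite sqr_sqrtr // addr_ge0 ?sqr_ge0. Qed.

Lemma normc_ge0 z : 0 <= normc z.
Proof. by case: z => a b /=; rewrite sqrtr_ge0. Qed.

Lemma normc_real (x : R) : normc x%:C = `|x|.
Proof. by rewrite /= expr0n addr0 sqrtr_sqr. Qed.

Lemma normc_prod (I : finType) (G : I -> R[i]) :
  normc (\prod_i G i) = \prod_i normc (G i).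
Proof.
apply: (big_morph _ (@ComplexField.Normc.normcM R)).
exact: ComplexField.Normc.normc1.
Qed.

Lemma normc_sum (I : finType) (G : I -> R[i]) :
  normc (\sum_i G i) <= \sum_i normc (G i).
Proof.
elim/big_ind2: _ => // [|x1 y1 x2 y2 h1 h2].
  by rewrite ComplexField.Normc.normc0.
by apply: le_trans (le_normcD _ _) _; rewrite lerD.
Qed.

End Normc.

(** The case of [three_point_defect] where one rescaled factor Y is far from 1:
    a large Y means that r t is at most a multiple of Y - 1, so that this one
    term suffices. *)
Lemma defect_ge_of_large_factor (F : realFieldType) (r s t Y d : F) :
  0 <= r -> 1 <= s -> 0 <= t -> 0 <= d <= 1 -> r * t <= 1 + s * Y ->
  5 / 3 <= Y -> 3 * d ^+ 4 * (r * t) ^+ 2 <= 64 * s ^+ 4 * (Y - 1) ^+ 2.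
Proof.
move=> r0 s1 t0 /andP[d0 d1] rt hY.
have h : r * t <= s ^+ 2 * (4 * (Y - 1)).
  have a : 0 <= (s - 1) * (s + 1 + s * Y).
    by apply: mulr_ge0; first lra; rewrite !addr_ge0 ?mulr_ge0 //; lra.
  have b : 0 <= s ^+ 2 * (3 * Y - 5) by rewrite mulr_ge0 ?sqr_ge0 //; lra.
  lra.
have h2 : (r * t) ^+ 2 <= (s ^+ 2 * (4 * (Y - 1))) ^+ 2.
  by rewrite ler_sqr // nnegrE ?mulr_ge0 ?sqr_ge0 //; lra.
have d4 : d ^+ 4 <= 1 by rewrite exprn_ile1.
have e : (s ^+ 2 * (4 * (Y - 1))) ^+ 2 = 16 * (s ^+ 4 * (Y - 1) ^+ 2) by ring.
have q0 : 0 <= s ^+ 4 * (Y - 1) ^+ 2 by rewrite mulr_ge0 ?sqr_ge0 ?exprn_ge0 //; lra.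
have g : d ^+ 4 * (r * t) ^+ 2 <= 1 * (r * t) ^+ 2 by rewrite ler_wpM2r ?sqr_ge0.
move: h2 q0 g; rewrite e -!mulrA; lra.
Qed.

(** Y^2 is affine in the point of the circle and Y is not; for bounded Y the
    deviation of Y from 1 controls that of Y^2. *)
Lemma sqr_sub1_le (F : realFieldType) (Y : F) :
  0 <= Y <= 5 / 3 -> (Y ^+ 2 - 1) ^+ 2 <= 64 / 9 * (Y - 1) ^+ 2.
Proof.
move=> /andP[Y0 Y1].
have -> : (Y ^+ 2 - 1) ^+ 2 = (Y + 1) ^+ 2 * (Y - 1) ^+ 2 by ring.
by rewrite ler_wpM2r ?sqr_ge0 //; nra.
Qed.

(** Unless some Y exceeds 5/3, pass to X = Y^2: differences of the values of X
    at two points are multiples of Re ((u - v) z), which are controlled from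
    below by [triangle_projections], and from above by the deviations of the
    three values of X from 1. *)
Lemma three_point_defect (R : realType) (r d : R) (u v w z : R[i]) :
  let s := Num.sqrt (1 + r ^+ 2) in
  let Y p := normc (1 + r%:C * p * z) / s in
  0 <= r -> 0 <= d <= 1 -> normc u = 1 -> normc v = 1 -> normc w = 1 ->
  d <= normc (u - v) -> d <= normc (v - w) -> d <= normc (w - u) ->
  3 * d ^+ 4 * (r * normc z) ^+ 2 <=
  64 * s ^+ 4 * ((Y u - 1) ^+ 2 + (Y v - 1) ^+ 2 + (Y w - 1) ^+ 2).
Proof.
move=> s Y r0 d01 u1 v1 w1 huv hvw hwu.
have s2 : s ^+ 2 = 1 + r ^+ 2 by rewrite sqr_sqrtr // addr_ge0 ?sqr_ge0.
have s1 : 1 <= s by rewrite -sqrtr1 ler_wsqrtr // lerDl sqr_ge0.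
have s0 : 0 < s by lra.
have Y0 p : 0 <= Y p by rewrite divr_ge0 ?normc_ge0 // ltW.
have sY p : s * Y p = normc (1 + r%:C * p * z).
  by rewrite /Y mulrC divfK // gt_eqF.
have tri p : normc p = 1 -> r * normc z <= 1 + s * Y p.
  move=> p1; rewrite sY.
  have -> : r * normc z = normc (r%:C * p * z).
    by rewrite !ComplexField.Normc.normcM p1 mulr1 normc_real ger0_norm.
  rewrite [in leLHS](_ : r%:C * p * z = (1 + r%:C * p * z) + (- 1)); last by ring.
  apply: le_trans (le_normcD _ _) _.
  have -> : normc (-1 : R[i]) = 1 by rewrite normcN ComplexField.Normc.normc1.
  by rewrite addrC.
have t0 := normc_ge0 z.
have q0 p : 0 <= 64 * s ^+ 4 * (Y p - 1) ^+ 2.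
  by rewrite mulr_ge0 ?sqr_ge0 // mulr_ge0 // exprn_ge0 // ltW.
rewrite !mulrDr.
have [Yu|Yu] := leP (5 / 3) (Y u).
  have := defect_ge_of_large_factor r0 s1 t0 d01 (tri u u1) Yu.
  by have := q0 v; have := q0 w; lra.
have [Yv|Yv] := leP (5 / 3) (Y v).
  have := defect_ge_of_large_factor r0 s1 t0 d01 (tri v v1) Yv.
  by have := q0 u; have := q0 w; lra.
have [Yw|Yw] := leP (5 / 3) (Y w).
  have := defect_ge_of_large_factor r0 s1 t0 d01 (tri w w1) Yw.
  by have := q0 u; have := q0 v; lra.
have X p : normc p = 1 -> (s * Y p) ^+ 2 =
    1 + r ^+ 2 * normc z ^+ 2 + 2 * r * (Re p * Re z - Im p * Im z).
  move=> p1; have p2 : Re p ^+ 2 + Im p ^+ 2 = 1 by rewrite -sqr_normcE p1 expr1n.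
  rewrite sY (_ : r ^+ 2 * normc z ^+ 2 =
    r ^+ 2 * (Re p ^+ 2 + Im p ^+ 2) * normc z ^+ 2); last by rewrite p2 mulr1.
  rewrite !sqr_normcE.
  by case: (p) (z) => p' p'' [x y] /=; ring.
have Xu := X u u1; have Xv := X v v1; have Xw := X w w1.
have lu := @sqr_sub1_le _ (Y u); have lv := @sqr_sub1_le _ (Y v).
have lw := @sqr_sub1_le _ (Y w).
have {lu} lu := lu (introT andP (conj (Y0 u) (ltW Yu))).
have {lv} lv := lv (introT andP (conj (Y0 v) (ltW Yv))).
have {lw} lw := lw (introT andP (conj (Y0 w) (ltW Yw))).
have unit (p : R[i]) : normc p = 1 -> Re p ^+ 2 + Im p ^+ 2 = 1.
  by move=> p1; rewrite -sqr_normcE p1 expr1n.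
have d0 : 0 <= d by case/andP: d01.
have dist (p q : R[i]) : d <= normc (p - q) ->
    d ^+ 2 <= (Re p - Re q) ^+ 2 + (Im p - Im q) ^+ 2.
  move=> h; have -> : (Re p - Re q) ^+ 2 + (Im p - Im q) ^+ 2 = normc (p - q) ^+ 2.
    by rewrite sqr_normcE; case: (p) (q) => [? ?] [? ?].
  by rewrite ler_sqr ?nnegrE ?normc_ge0.
have := @triangle_projections _ _ _ _ _ _ _ (Re z) (Im z) _ (unit u u1)
  (unit v v1) (unit w w1) (sqr_ge0 d) (dist _ _ huv) (dist _ _ hvw) (dist _ _ hwu).
rewrite -sqr_normcE -exprM mulnn.
set t := normc z in Xu Xv Xw *; set a := Re u * _ - _ in Xu *.
set b := Re v * _ - _ in Xv *; set c := Re w * _ - _ in Xw *.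
have -> : (Re u - Re v) * Re z - (Im u - Im v) * Im z = a - b by rewrite /a /b; ring.
have -> : (Re v - Re w) * Re z - (Im v - Im w) * Im z = b - c by rewrite /b /c; ring.
have -> : (Re w - Re u) * Re z - (Im w - Im u) * Im z = c - a by rewrite /c /a; ring.
move=> proj.
have {proj} proj := ler_wpM2l (sqr_ge0 r) proj.
pose xu := s ^+ 2 * (Y u ^+ 2 - 1); pose xv := s ^+ 2 * (Y v ^+ 2 - 1).
pose xw := s ^+ 2 * (Y w ^+ 2 - 1).
have dif : r ^+ 2 * (4 * ((a - b) ^+ 2 + (b - c) ^+ 2 + (c - a) ^+ 2)) =
    (xu - xv) ^+ 2 + (xv - xw) ^+ 2 + (xw - xu) ^+ 2.
  have -> : xu - xv = 2 * r * (a - b).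
    rewrite (_ : xu - xv = (s * Y u) ^+ 2 - (s * Y v) ^+ 2); last by rewrite /xu /xv; ring.
    by rewrite Xu Xv; ring.
  have -> : xv - xw = 2 * r * (b - c).
    rewrite (_ : xv - xw = (s * Y v) ^+ 2 - (s * Y w) ^+ 2); last by rewrite /xv /xw; ring.
    by rewrite Xv Xw; ring.
  have -> : xw - xu = 2 * r * (c - a).
    rewrite (_ : xw - xu = (s * Y w) ^+ 2 - (s * Y u) ^+ 2); last by rewrite /xw /xu; ring.
    by rewrite Xu Xw; ring.
  by ring.
rewrite dif in proj.
have bd : (xu - xv) ^+ 2 + (xv - xw) ^+ 2 + (xw - xu) ^+ 2 <=
    3 * (xu ^+ 2 + xv ^+ 2 + xw ^+ 2).
  rewrite -subr_ge0 (_ : _ - _ = (xu + xv + xw) ^+ 2) ?sqr_ge0 //; ring.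
have s4 : 0 <= s ^+ 4 by rewrite exprn_ge0 // ltW.
have hu := ler_wpM2l s4 lu; have hv := ler_wpM2l s4 lv; have hw := ler_wpM2l s4 lw.
have eu : xu ^+ 2 = s ^+ 4 * (Y u ^+ 2 - 1) ^+ 2 by rewrite /xu; ring.
have ev : xv ^+ 2 = s ^+ 4 * (Y v ^+ 2 - 1) ^+ 2 by rewrite /xv; ring.
have ew : xw ^+ 2 = s ^+ 4 * (Y w ^+ 2 - 1) ^+ 2 by rewrite /xw; ring.
rewrite -eu in hu; rewrite -ev in hv; rewrite -ew in hw.
have -> : 3 * d ^+ 4 * (r * t) ^+ 2 = 3 * (r ^+ 2 * (d ^+ (2 * 2) * t ^+ 2)) by ring.
move: proj bd hu hv hw; rewrite ![s ^+ 4 * (64 / 9 * _)]mulrCA -![64 * _ * _]mulrA.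
clearbody xu xv xw => *; lra.
Qed.

(** Since sum (y_i - 1)^2 = 2n - 2 sum y_i, the mean of the y_i is 1 - D/(2n),
    and 1 - x <= exp(-x). *)
Lemma AGM_defect (R : realType) n (y : 'I_n -> R) :
  (0 < n)%N -> (forall i, 0 <= y i) -> \sum_i y i ^+ 2 = n%:R ->
  \prod_i y i <= expR (- (\sum_i (y i - 1) ^+ 2) / 2).
Proof.
move=> n0 y0 sy; set D := \sum_i (y i - 1) ^+ 2.
have nR : (0 : R) < n%:R by rewrite ltr0n.
have mean : (\sum_i y i) / n%:R = 1 - D / (2 * n%:R).
  have -> : D = \sum_i y i ^+ 2 - 2 * \sum_i y i + n%:R.
    have -> : n%:R = \sum_(i < n) (1 : R) by rewrite sumr_const card_ord.
    rewrite mulr_sumr.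
    rewrite -sumrN -!big_split /=; apply: eq_bigr => i _; ring.
  by rewrite sy; field; lra.
have := (@leif_AGM R _ 'I_n y _).1 => /= /(_ (fun i _ => y0 i)).
rewrite card_ord => h; apply: le_trans h _; rewrite mean.
have -> : - D / 2 = n%:R * (- (D / (2 * n%:R))) by field; lra.
rewrite expRM_natl lerXn2r ?nnegrE ?expR_ge0 ?expR_ge1Dx //.
by rewrite -mean divr_ge0 ?sumr_ge0 // ltW.
Qed.

Lemma expRN_half_le1 (R : realType) (x : R) : 0 <= x -> expR (- x / 2) <= 1.
Proof. by move=> x0; rewrite -[leRHS]expR0 ler_expR; lra. Qed.

(** From exp(x/2) >= (1 + x/4)^2 >= x. *)
Lemma expRN_half_mul_le1 (R : realType) (x : R) : 0 <= x -> expR (- x / 2) * x <= 1.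
Proof.
move=> x0.
have h : 1 + x / 4 <= expR (x / 4) := expR_ge1Dx _.
have e : expR (- x / 2) * (expR (x / 4) * expR (x / 4)) = 1.
  by rewrite -!expRD -[RHS]expR0; congr expR; field.
have g : x <= expR (x / 4) * expR (x / 4).
  apply: le_trans (_ : (1 + x / 4) * (1 + x / 4) <= _); last by rewrite ler_pM //; lra.
  by rewrite -subr_ge0 (_ : _ - x = (1 - x / 4) ^+ 2) ?sqr_ge0 //; field.
by rewrite -[leRHS]e ler_wpM2l ?expR_ge0.
Qed.

(** * Binomial coefficients and entropy *)

Lemma expr1D_ge_cubic (F : realFieldType) (x : F) (n : nat) : 0 <= x ->
  1 + n%:R * x + n%:R * (n%:R - 1) / 2 * x ^+ 2
    + n%:R * (n%:R - 1) * (n%:R - 2) / 6 * x ^+ 3 <= (1 + x) ^+ n.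
Proof.
move=> x0; elim: n => [|n IHn]; first by rewrite expr0; lra.
have ff : 0 <= n%:R * (n%:R - 1) * (n%:R - 2) :> F.
  case: n {IHn} => [|[|n]]; try lra.
  rewrite -!natr1; have := ler0n F n => h.
  by rewrite !mulr_ge0 //; lra.
rewrite [leRHS]exprSr; apply: le_trans (_ : _ <= (1 + n%:R * x + n%:R * (n%:R - 1) / 2 * x ^+ 2
    + n%:R * (n%:R - 1) * (n%:R - 2) / 6 * x ^+ 3) * (1 + x)) _; last first.
  by rewrite ler_wpM2r //; lra.
rewrite -natr1 -subr_ge0.
have -> : forall a : F, (1 + a * x + a * (a - 1) / 2 * x ^+ 2
    + a * (a - 1) * (a - 2) / 6 * x ^+ 3) * (1 + x) -
  (1 + (a + 1) * x + (a + 1) * (a + 1 - 1) / 2 * x ^+ 2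
    + (a + 1) * (a + 1 - 1) * (a + 1 - 2) / 6 * x ^+ 3) =
  a * (a - 1) * (a - 2) / 6 * x ^+ 4 by move=> a; field.
by rewrite mulr_ge0 ?exprn_ge0 // divr_ge0.
Qed.

(** (1 + 1/m)^(2m+1) decreases (to e^2).  The quotient of two successive bases
    is 1 + x with x = 1/(m(m+2)), and the claim becomes
    ((m+2)/(m+1))^2 <= (1 + x)^(2m+1).  Both sides agree to second order in
    1/m, which is why the binomial expansion is needed up to x^3. *)
Lemma succ_ratio_expr_decr (F : realFieldType) (m : nat) : (0 < m)%N ->
  (m.+2%:R / m.+1%:R : F) ^+ (m.+1).*2.+1 <= (m.+1%:R / m%:R) ^+ m.*2.+1.
Proof.
case: m => // m _; pose h : F := m%:R.
have h0 : 0 <= h by rewrite ler0n.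
have -> : m.+3%:R = h + 3 :> F by rewrite -natr1 -natr1 -natr1; lra.
have -> : m.+2%:R = h + 2 :> F by rewrite -natr1 -natr1; lra.
have -> : m.+1%:R = h + 1 :> F by rewrite -natr1.
pose q := (h + 3) / (h + 2); pose x := ((h + 1) * (h + 3))^-1.
have x0 : 0 <= x by rewrite invr_ge0 mulr_ge0; lra.
have -> : (h + 2) / (h + 1) = (1 + x) * q.
  by rewrite /x /q; field; rewrite !lt0r_neq0 //; lra.
have q0 : 0 <= q by rewrite divr_ge0; lra.
have -> : m.+2.*2.+1 = (m.+1.*2.+1 + 2)%N by lia.
rewrite -/q exprD [leRHS]exprMn mulrC ler_wpM2r ?exprn_ge0 //.
apply: le_trans (expr1D_ge_cubic _ x0).
have -> : m.+1.*2.+1%:R = 2 * h + 3 :> F.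
  by rewrite -muln2 -natr1 natrM -natr1 -/h; lra.
rewrite -subr_ge0.
rewrite (_ : _ - _ = (78 + 220 * h + 220 * h ^+ 2 + 96 * h ^+ 3 + 20 * h ^+ 4
   + 2 * h ^+ 5) / (6 * (h + 2) ^+ 2 * ((h + 1) * (h + 3)) ^+ 3)).
  by rewrite divr_ge0 ?mulr_ge0 ?exprn_ge0 ?mulr_ge0 ?addr_ge0 ?mulr_ge0 ?exprn_ge0 //; lra.
by rewrite /x /q; field; rewrite !lt0r_neq0 //; lra.
Qed.

Lemma succ_ratio_expr_antitone (F : realFieldType) (m n : nat) :
  (0 < m <= n)%N ->
  (n.+1%:R / n%:R : F) ^+ n.*2.+1 <= (m.+1%:R / m%:R) ^+ m.*2.+1.
Proof.
case/andP=> m0 /subnK <-; elim: (n - m)%N => [|d IHd] //.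
by apply: le_trans IHd; rewrite addSn succ_ratio_expr_decr // addn_gt0 m0 orbT.
Qed.

(** Going from m to m + 1 multiplies the left side by
    (n+1)^2 (1 + 1/n)^(2n+1), where n = k + m, and the right side by
    (n+1)^2 (1 + 1/m)^(2m+1). *)
Lemma bin_entropy_lower_step (F : realFieldType) (k m : nat) :
  (0 < k)%N -> (0 < m)%N ->
  ((k + m)%:R : F) ^+ (k + m).*2.+1 <=
    8 * 'C(k + m, k)%:R ^+ 2 * k%:R ^+ k.*2.+1 * m%:R ^+ m.*2.+1 ->
  ((k + m.+1)%:R : F) ^+ (k + m.+1).*2.+1 <=
    8 * 'C(k + m.+1, k)%:R ^+ 2 * k%:R ^+ k.*2.+1 * m.+1%:R ^+ m.+1.*2.+1.
Proof.
move=> k0 m0; set n := (k + m)%N => IH; rewrite addnS -/n.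
have n0 : (0 < n)%N by rewrite addn_gt0 k0.
have nR : 0 < n%:R :> F by rewrite ltr0n.
have mR : 0 < m%:R :> F by rewrite ltr0n.
have binE : m.+1%:R * 'C(n.+1, k)%:R = n.+1%:R * 'C(n, k)%:R :> F.
  by rewrite -!natrM; congr _%:R; rewrite (mul_bin_down n.+1 k) /n; congr (_ * _)%N; lia.
have -> : 8 * 'C(n.+1, k)%:R ^+ 2 * k%:R ^+ k.*2.+1 * m.+1%:R ^+ m.+1.*2.+1 =
   n.+1%:R ^+ 2 * (8 * 'C(n, k)%:R ^+ 2 * k%:R ^+ k.*2.+1 * m.+1%:R ^+ m.*2.+1) :> F.
  rewrite doubleS -[m.*2.+3]addn2 exprD.
  transitivity (8 * (m.+1%:R * 'C(n.+1, k)%:R) ^+ 2 * k%:R ^+ k.*2.+1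
     * m.+1%:R ^+ m.*2.+1 : F); first by ring.
  by rewrite binE; ring.
rewrite doubleS -[n.*2.+3]addn2 exprD mulrC ler_wpM2l ?sqr_ge0 //.
have [pn pm] : n.+1%:R ^+ n.*2.+1 = (n.+1%:R / n%:R) ^+ n.*2.+1 * n%:R ^+ n.*2.+1 :> F
   /\ m.+1%:R ^+ m.*2.+1 = (m.+1%:R / m%:R) ^+ m.*2.+1 * m%:R ^+ m.*2.+1 :> F.
  by split; rewrite -exprMn divfK // gt_eqF.
rewrite pn pm mulrCA.
apply: ler_pM => //; rewrite ?exprn_ge0 ?divr_ge0 ?ler0n //.
by apply: succ_ratio_expr_antitone; rewrite m0 leq_addl.
Qed.

(** With n = k + m this is C(n,k) >= n^n / (k^k m^m) / sqrt(8 k m / n), an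
    explicit form of Stirling's lower bound.  The constant 8 is the one for
    k = m = 1, where equality holds: the ratio of the two sides is monotone in
    each of k and m, so no asymptotics are needed. *)
Lemma bin_entropy_lower (F : realFieldType) (k m : nat) :
  (0 < k)%N -> (0 < m)%N ->
  ((k + m)%:R : F) ^+ (k + m).*2.+1 <=
    8 * 'C(k + m, k)%:R ^+ 2 * k%:R ^+ k.*2.+1 * m%:R ^+ m.*2.+1.
Proof.
move=> k0; case: m => // m _; elim: m => [|m IHm]; last exact: bin_entropy_lower_step.
have bin1C : 'C(k + 1, k) = 'C(1 + k, 1) by rewrite -bin_sub ?leq_addr // addKn addnC.
have {k0} : ((1 + k)%:R : F) ^+ (1 + k).*2.+1 <=
    8 * 'C(1 + k, 1)%:R ^+ 2 * 1%:R ^+ 3 * k%:R ^+ k.*2.+1.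
  case: k k0 {bin1C} => // k _; elim: k => [|k IHk]; first by rewrite bin1 expr1n; lra.
  exact: bin_entropy_lower_step.
by rewrite bin1C [(k + 1)%N]addnC mulrAC.
Qed.

(** * Sums over points with few small values *)

(** Comparison with the integral of x^(-4), telescoped. *)
Lemma sum_inv_pow4 (F : realFieldType) (b c : nat) : (0 < b <= c)%N ->
  \sum_(b <= i < c) (i.+1%:R ^- 4 : F) <= (b%:R ^- 3 - c%:R ^- 3) / 3.
Proof.
case/andP=> b0 /subnK <-; elim: (c - b)%N => [|d IHd].
  by rewrite add0n big_geq // subrr mul0r.
rewrite addSn big_nat_recr ?leq_addl //=.
have d0 : 0 < (d + b)%:R :> F by rewrite ltr0n addn_gt0 b0 orbT.
move: IHd d0; set x := (d + b)%:R => IHd d0.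
have -> : (d + b).+1%:R = x + 1 :> F by rewrite -natr1.
have step : (x + 1) ^- 4 <= (x ^- 3 - (x + 1) ^- 3) / 3.
  rewrite -subr_ge0 (_ : _ - _ = (6 * x ^+ 2 + 4 * x + 1) / (3 * x ^+ 3 * (x + 1) ^+ 4)).
    by rewrite divr_ge0 ?mulr_ge0 ?exprn_ge0 ?addr_ge0 ?mulr_ge0 ?exprn_ge0 //; lra.
  by field; rewrite !lt0r_neq0 //; lra.
lra.
Qed.

(** The first j + 1 entries of a sorted enumeration all lie in the sublevel set
    of its j-th entry. *)
Lemma count_sort_prefix (R : realFieldType) N (E : 'I_N -> R) (x0 : 'I_N) (j : nat) :
  let s := sort (fun i i' => E i <= E i') (enum 'I_N) in
  (j < N)%N -> (j < #|[pred i | (E i <= E (nth x0 s j))%R]|)%N.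
Proof.
move=> s jN.
have ssz : size s = N by rewrite size_sort size_enum_ord.
have srt : sorted (fun i i' => E i <= E i') s.
  by apply: sort_sorted => i i'; apply: le_total.
have us : uniq (take j.+1 s) by rewrite take_uniq // sort_uniq enum_uniq.
have <- : size (take j.+1 s) = j.+1 by rewrite size_takel // ssz.
rewrite -(card_uniqP us); apply/subset_leq_card/subsetP => i /(nthP x0) [l].
rewrite size_takel ?ssz // ltnS => lj; rewrite nth_take // => <-.
rewrite inE; apply: (sorted_leq_nth _ _ x0 srt) => //.
- by move=> a b c; apply: le_trans.
- by rewrite inE ssz (leq_ltn_trans lj).
- by rewrite inE ssz.
Qed.

Lemma exists_fourth_root (R : realType) (x : R) : 0 <= x ->
  exists2 y, 0 <= y & x = y ^+ 4.
Proof.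
move=> x0; exists (Num.sqrt (Num.sqrt x)); first exact: sqrtr_ge0.
by rewrite (exprM _ 2 2) !sqr_sqrtr ?sqrtr_ge0.
Qed.

(** Order the points by E: the hypothesis on the sublevel sets says that the
    value in position j (from 0) is at least ((j-1)/4M)^4, up to the level 1.
    The first 4M beta terms or so are bounded by 1, the following ones by
    beta^4 (4M/(j-1))^4, and those beyond 4M by beta^4.  Altogether this is
    6M (8/9 beta + 1/9 beta^4) + 3, and beta^4 <= beta. *)
Lemma sum_le_of_sublevel_count (R : realType) (M : nat) (E F : 'I_(6 * M) -> R)
    (beta : R) :
  (0 < M)%N -> 0 < beta < 1 ->
  (forall j, 0 <= E j) -> (forall j, F j <= 1) ->
  (forall j, F j * E j <= beta ^+ 4) ->
  (forall d : R, 0 <= d < 1 ->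
     #|[pred j | E j <= d ^+ 4]|%:R <= 4 * M%:R * d + 2) ->
  \sum_j F j <= (6 * M)%:R * beta + 3.
Proof.
move=> M0 /andP[b0 b1] E0 F1 FE cnt.
have N0 : (0 < 6 * M)%N by rewrite muln_gt0.
pose x0 : 'I_(6 * M) := Ordinal N0.
pose s := sort (fun i i' => E i <= E i') (enum 'I_(6 * M)).
have ssz : size s = (6 * M)%N by rewrite size_sort size_enum_ord.
pose f j := F (nth x0 s j).
have -> : \sum_j F j = \sum_(0 <= j < 6 * M) f j.
  rewrite -[in RHS]ssz -(big_nth x0 xpredT F).
  have ps : perm_eq s (enum 'I_(6 * M)) by rewrite /s perm_sort.
  by rewrite (perm_big _ ps) big_enum.
have MR : 0 < M%:R :> R by rewrite ltr0n.
pose a : R := 4 * M%:R.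
have a0 : 0 < a by rewrite mulr_gt0.
(* Two of the j + 1 smallest values are absorbed by the constant 2 of the
     hypothesis, hence the shift of j + 1 to j - 1. *)
have small j : (j < 6 * M)%N -> E (nth x0 s j) < 1 ->
    exists2 d : R, 0 <= d < 1 /\ E (nth x0 s j) = d ^+ 4 & j%:R - 1 <= a * d.
  move=> jN Ej1; have [d d0 dE] := exists_fourth_root (E0 (nth x0 s j)).
  have d1 : d < 1 by rewrite ltNge; apply/negP => /(exprn_ege1 4); rewrite -dE leNgt Ej1.
  exists d; first by rewrite d0.
  have := cnt d; rewrite d0 d1 => /(_ isT).
  have := count_sort_prefix E x0 jN; rewrite -/s dE => h.
  have : j.+1%:R <= #|[pred i | E i <= d ^+ 4]|%:R :> R by rewrite ler_nat.
  by rewrite -natr1 /a; lra.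
have b4 : 0 < beta ^+ 4 by rewrite exprn_gt0.
have Fle1 j : 1 <= E (nth x0 s j) -> f j <= beta ^+ 4.
  move=> Ej; have [f0|f0] := leP (f j) 0; first by apply: le_trans f0 _; exact: ltW.
  by apply: le_trans (FE (nth x0 s j)); rewrite ler_peMr // ltW.
have mid j : (0 < j)%N -> (j <= 4 * M)%N -> f j.+1 <= beta ^+ 4 * a ^+ 4 * j%:R ^- 4.
  move=> j0 jM; have jR : 0 < j%:R :> R by rewrite ltr0n.
  have j4 : 0 < j%:R ^+ 4 :> R by rewrite exprn_gt0.
  have ja : j%:R <= a by rewrite /a -natrM ler_nat.
  have ja4 : j%:R ^+ 4 <= a ^+ 4 by rewrite lerXn2r // nnegrE ltW.
  rewrite ler_pdivlMr //.
  have jN : (j.+1 < 6 * M)%N by lia.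
  have [f0|f0] := leP (f j.+1) 0.
    apply: (@le_trans _ _ 0); first by rewrite mulr_le0_ge0 // ltW.
    by rewrite mulr_ge0 ?exprn_ge0 // ltW.
  have [E1|E1] := leP 1 (E (nth x0 s j.+1)).
    by apply: ler_pM (Fle1 _ E1) ja4; apply: ltW.
  have [d [/andP[d0 d1] dE]] := small _ jN E1.
  rewrite -natr1 addrK => jd.
  have jd4 : j%:R ^+ 4 <= a ^+ 4 * d ^+ 4.
    by rewrite -exprMn lerXn2r // nnegrE ?(ltW jR) // mulr_ge0 // ltW.
  apply: le_trans (ler_wpM2l (ltW f0) jd4) _.
  by rewrite mulrCA mulrC ler_wpM2r ?exprn_ge0 ?(ltW a0) // -dE FE.
have far j : (4 * M + 2 <= j < 6 * M)%N -> f j <= beta ^+ 4.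
  case/andP=> j1 j2; apply: Fle1; rewrite leNgt; apply/negP => E1.
  have [d [/andP[d0 d1] dE]] := small _ j2 E1.
  have : (4 * M + 2)%:R <= j%:R :> R by rewrite ler_nat.
  have : a * d < a by rewrite gtr_pMr.
  by rewrite natrD natrM -/a; lra.
pose b := (Num.truncn (a * beta)).+1.
have ab0 : 0 < a * beta by rewrite mulr_gt0.
have /andP[tb1 tb2] := truncn_itv (ltW ab0).
have bM : (b <= 4 * M)%N.
  rewrite -(ltr_nat R); apply: le_lt_trans tb1 _.
  by rewrite natrM gtr_pMr.
rewrite (@big_cat_nat _ _ _ b.+2) //=; last by lia.
rewrite (@big_cat_nat _ _ _ (4 * M + 2) b.+2) //=; [|lia..].
have p1 : \sum_(0 <= j < b.+2) f j <= a * beta + 3.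
  apply: le_trans (_ : \sum_(0 <= j < b.+2) (1 : R) <= _).
    by apply: ler_sum => j _; apply: F1.
  rewrite sumr_const_nat subn0 /b -!natr1; lra.
have p2 : \sum_(b.+2 <= j < 4 * M + 2) f j <= a * beta / 3 - a * beta ^+ 4 / 3.
  apply: le_trans (_ : beta ^+ 4 * a ^+ 4 * \sum_(b <= j < 4 * M) (j.+1%:R ^- 4) <= _).
    rewrite mulr_sumr -(addn2 b) big_addn addnK !big_nat; apply: ler_sum => i /andP[_ iM].
    by rewrite addn2 mid.
  apply: le_trans (ler_wpM2l _ (sum_inv_pow4 R _)) _.
  - by rewrite mulr_ge0 ?exprn_ge0 // ltW.
  - by rewrite bM.
  have -> : (4 * M)%:R = a by rewrite natrM.
  have inv3 : b%:R ^- 3 <= (a * beta) ^- 3.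
    by rewrite lef_pV2 ?posrE ?exprn_gt0 ?ltr0n // lerXn2r ?nnegrE ?ler0n // ltW.
  have -> : a * beta / 3 - a * beta ^+ 4 / 3 =
     beta ^+ 4 * a ^+ 4 * (((a * beta) ^- 3 - a ^- 3) / 3).
    by field; rewrite !lt0r_neq0.
  by rewrite ler_wpM2l ?mulr_ge0 ?exprn_ge0 ?(ltW a0) ?(ltW b0) //; lra.
have p3 : \sum_(4 * M + 2 <= j < 6 * M) f j <= a * beta ^+ 4 / 2.
  apply: le_trans (_ : \sum_(4 * M + 2 <= j < 6 * M) beta ^+ 4 <= _).
    by rewrite !big_nat; apply: ler_sum => j; apply: far.
  rewrite sumr_const_nat -[leLHS]mulr_natl [leRHS]mulrAC ler_wpM2r ?(ltW b4) //.
  rewrite ler_pdivlMr // /a -!natrM ler_nat; lia.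
have bb : M%:R * beta ^+ 4 <= M%:R * beta.
  by rewrite ler_pM2l // exprS ger_pMr // exprn_ile1 // ltW.
rewrite natrM; move: p1 p2 p3; rewrite /a; lra.
Qed.

(** * Roots of unity *)

Definition cis (R : realType) (t : R) : R[i] := (cos t) +i* (sin t).

Section Cis.
Variable R : realType.
Implicit Types (a b t : R).

Lemma cisD a b : cis (a + b) = cis a * cis b.
Proof. by apply/eqP; rewrite eq_complex /= cosD sinD addrC [_ * sin b + _]addrC !eqxx. Qed.

Lemma cisMn t j : cis (t *+ j) = cis t ^+ j.
Proof.
elim: j => [|j IHj]; last by rewrite mulrSr cisD IHj exprSr.
by rewrite mulr0n expr0 /cis cos0 sin0.
Qed.

Lemma normc_cis t : normc (cis t) = 1.
Proof. by rewrite /= cos2Dsin2 sqrtr1. Qed.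

Lemma cis_chord a b : normc (cis a - cis b) = 2 * `|sin ((a - b) / 2)|.
Proof.
rewrite /= (_ : _ + _ = (2 * sin ((a - b) / 2)) ^+ 2).
  by rewrite sqrtr_sqr normrM ger0_norm.
set h := (a - b) / 2.
have -> : a = b + h *+ 2 by rewrite /h mulr2n; field.
rewrite cosD sinD cos_mulr2n sin_mulr2n.
have := cos2Dsin2 b; have := cos2Dsin2 h.
set ch := cos h; set sh := sin h; set cb := cos b; set sb := sin b => e1 e2.
have -> : (cb * (ch ^+ 2 *+ 2 - 1) - sb * ((ch * sh) *+ 2) - cb) ^+ 2 +
  (sb * (ch ^+ 2 *+ 2 - 1) + cb * ((ch * sh) *+ 2) - sb) ^+ 2 =
  (cb ^+ 2 + sb ^+ 2) * ((2 * (ch ^+ 2 - 1)) ^+ 2 + (2 * (ch * sh)) ^+ 2) by ring.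
rewrite e2 mul1r (_ : ch ^+ 2 = 1 - sh ^+ 2); last by rewrite -e1 addrK.
have -> : (2 * (ch * sh)) ^+ 2 = 4 * ch ^+ 2 * sh ^+ 2 by ring.
rewrite (_ : ch ^+ 2 = 1 - sh ^+ 2); last by rewrite -e1 addrK.
ring.
Qed.

Lemma sin_pi6 : sin (pi / 6 : R) = 1 / 2.
Proof.
have pi0 := pi_gt0 R.
set x : R := pi / 6.
have s0 : 0 < sin x by apply: sin_gt0_pi; rewrite /x; lra.
have : sin (x *+ 2 + x) = 1 by rewrite -[RHS](sin_pihalf R); congr sin; rewrite /x; field.
rewrite sinD sin_mulr2n cos_mulr2n.
have := cos2Dsin2 x; set c := cos x; set s := sin x in s0 * => e1.
have -> : (c * s) *+ 2 * c + (c ^+ 2 *+ 2 - 1) * s = s * (4 * c ^+ 2 - 1) by ring.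
rewrite (_ : c ^+ 2 = 1 - s ^+ 2); last by rewrite -e1 addrK.
move=> e.
have : (s + 1) * (2 * s - 1) ^+ 2 == 0.
  apply/eqP; rewrite (_ : _ * _ = 1 - s * (4 * (1 - s ^+ 2) - 1)); last by ring.
  by rewrite e subrr.
by rewrite mulf_eq0 sqrf_eq0 => /orP[/eqP|/eqP]; lra.
Qed.

Lemma sin_ge_half (x : R) : pi / 6 <= x <= pi / 2 -> 1 <= 2 * sin x.
Proof.
have pi0 := pi_gt0 R.
move=> /andP[h1 h2].
have : sin (pi / 6) <= sin x.
  move: h1; rewrite le_eqVlt => /orP[/eqP -> //|h1]; apply: ltW.
  by rewrite ltr_sin // in_itv /=; apply/andP; split; lra.
by rewrite sin_pi6; lra.
Qed.

(** The sine is concave on [0, pi], so on an arithmetic progression starting at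
    0 the ratio sin(jh)/j decreases; concavity is used in the discrete form
    sin(a - h) + sin(a + h) = 2 sin a cos h <= 2 sin a. *)
Lemma sin_progression (h : R) (m d : nat) : 0 <= h -> m%:R * h <= pi ->
  (d <= m)%N -> d%:R * sin (m%:R * h) <= m%:R * sin (d%:R * h).
Proof.
move=> h0 hm.
have step j : (j < m)%N -> j%:R * sin (j.+1%:R * h) <= j.+1%:R * sin (j%:R * h).
  elim: j => [|j IHj] jm; first by rewrite mul0r mul1r !mul0r sin0.
  have {IHj} := IHj (ltnW jm).
  have -> : j.+2%:R * h = j.+1%:R * h + h by rewrite -natr1 mulrDl mul1r.
  have -> : j%:R * h = j.+1%:R * h - h by rewrite -natr1 mulrDl mul1r addrK.
  rewrite sinB sinD.
  have s0 : 0 <= sin (j.+1%:R * h).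
    apply: sin_ge0_pi; rewrite mulr_ge0 ?ler0n //=; apply: le_trans hm.
    by rewrite ler_wpM2r // ler_nat ltnW.
  have := cos_le1 h; set c := cos h; move: s0; set s := sin _ => s0 c1.
  have jp : 0 <= j.+1%:R :> R by rewrite ler0n.
  have : 0 <= j.+1%:R * (s * (1 - c)) by rewrite !mulr_ge0 //; lra.
  rewrite -[j.+2%:R]natr1; rewrite -!natr1 in jp *.
  lra.
elim: m hm step => [|m IHm] hm step; first by rewrite leqn0 => /eqP ->; rewrite !mul0r.
rewrite leq_eqVlt => /orP[/eqP -> //|]; rewrite ltnS => dm.
case: m hm IHm dm step => [|m] hm IHm dm step.
  by move: dm; rewrite leqn0 => /eqP ->; rewrite !mul0r sin0 mulr0.
have m0 : 0 < m.+1%:R :> R by rewrite ltr0n.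
rewrite -(ler_pM2l m0).
have hm' : m.+1%:R * h <= pi.
  by apply: le_trans hm; rewrite ler_wpM2r // ler_nat.
have := IHm hm' (fun j jm => step j (ltnW jm)) dm.
have := step m.+1 (ltnSn _).
set p := sin (m.+2%:R * h); set q := sin (m.+1%:R * h); set w := sin _ => a b.
have a' := ler_wpM2l (ler0n R d) a; have b' := ler_wpM2l (ler0n R m.+2) b.
lra.
Qed.

End Cis.

Section RootsOfUnity.
Variables (R : realType) (M : nat).
Hypothesis M0 : (0 < M)%N.

(** The number of points is a multiple of 6 so that one of them is at distance
    exactly 1 from the point 1. *)
Definition root6 (j : nat) : R[i] := cis (2 * pi / (6 * M)%:R *+ j).

Let MR : 0 < M%:R :> R. Proof. by rewrite ltr0n. Qed.

(** The chord from 1 to the d-th of the 6M-th roots of unity has length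
    2 sin(pi d / 6M); the chord for d = M has length 1, and concavity bounds the
    shorter ones below linearly. *)
Lemma chord_lower (d : nat) : (d <= 3 * M)%N ->
  2 * sin (pi / (6 * M)%:R *+ d) < 1 :> R ->
  d%:R <= M%:R * (2 * sin (pi / (6 * M)%:R *+ d)) :> R.
Proof.
move=> dM; have pi0 := pi_gt0 R.
have piM : pi / (6 * M)%:R * M%:R = pi / 6 :> R by rewrite natrM; field; rewrite gt_eqF.
have h0 : 0 <= pi / (6 * M)%:R :> R by rewrite divr_ge0 ?ler0n // ltW.
have [dM'|dM'] := leqP d M.
  move=> _; have := @sin_progression R (pi / (6 * M)%:R) M d h0.
  rewrite [M%:R * (_ / _)]mulrC piM sin_pi6 [d%:R * (pi / _)]mulr_natl.
  have pi6 : pi / 6 <= pi :> R by lra.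
  by move=> /(_ pi6 dM'); lra.
move=> lt1; suff : 1 <= 2 * sin (pi / (6 * M)%:R *+ d) :> R by rewrite leNgt lt1.
apply: sin_ge_half; rewrite -[_ *+ d]mulr_natr -piM; apply/andP; split.
  by rewrite ler_wpM2l // ler_nat ltnW.
have -> : pi / 2 = pi / (6 * M)%:R * (3 * M)%:R :> R by rewrite !natrM; field; rewrite gt_eqF.
by rewrite ler_wpM2l // ler_nat.
Qed.

Lemma normc_root6_sub i j : (j <= i <= 6 * M)%N ->
  normc (root6 i - root6 j) = 2 * sin (pi / (6 * M)%:R *+ (i - j)) :> R.
Proof.
case/andP=> ji iM; have pi0 := pi_gt0 R; rewrite cis_chord.
have -> : (2 * pi / (6 * M)%:R *+ i - 2 * pi / (6 * M)%:R *+ j) / 2 =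
   pi / (6 * M)%:R *+ (i - j) :> R.
  rewrite -mulrnBr // -[X in X / 2]mulr_natr -[RHS]mulr_natr mulrAC.
  by congr (_ * _); rewrite -[2 * pi / _]mulrA [2 * _]mulrC mulfK // pnatr_eq0.
rewrite ger0_norm //; apply: sin_ge0_pi; rewrite mulrn_wge0 ?divr_ge0 ?ler0n ?(ltW pi0) //=.
rewrite -mulr_natr mulrAC ler_pdivrMr ?ltr0n ?muln_gt0 //.
by rewrite ler_wpM2l ?(ltW pi0) // ler_nat; lia.
Qed.

Lemma close_roots6 (delta : R) i j : (j <= i < 6 * M)%N -> delta < 1 ->
  normc (root6 i - root6 j) <= delta ->
  (i - j)%:R <= M%:R * delta \/ (6 * M - (i - j))%:R <= M%:R * delta.
Proof.
case/andP=> ji iM d1; rewrite normc_root6_sub ?ji ?(ltnW iM) //.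
set d := (i - j)%N => close.
have dM : (d <= 6 * M)%N by rewrite /d; lia.
have [d3|d3] := leqP d (3 * M); [left|right].
  apply: le_trans (chord_lower d3 _) _; first exact: le_lt_trans d1.
  by rewrite ler_wpM2l // ltW.
have e : sin (pi / (6 * M)%:R *+ d) = sin (pi / (6 * M)%:R *+ (6 * M - d)) :> R.
  have -> : pi / (6 * M)%:R *+ (6 * M - d) = pi - pi / (6 * M)%:R *+ d :> R.
    by rewrite mulrnBr // -[X in X - _]mulr_natr divfK // pnatr_eq0; lia.
  by rewrite sinB sinpi cospi; lra.
rewrite e in close.
apply: le_trans (chord_lower _ _) _; first by lia.
  exact: le_lt_trans d1.
by rewrite ler_wpM2l // ltW.
Qed.

(** The indices of these points are within e, the integer part of M delta, of
    i cyclically; the shift by e - i modulo 6M sends them into 0, ..., 2e. *)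
Lemma card_close_roots6 (delta : R) (i : 'I_(6 * M)) : 0 <= delta < 1 ->
  #|[pred j : 'I_(6 * M) | normc (root6 i - root6 j) <= delta]|%:R
    <= 2 * M%:R * delta + 1.
Proof.
case/andP=> d0 d1; have Md0 : 0 <= M%:R * delta by rewrite mulr_ge0 // ltW.
have /andP[e1 e2] := truncn_itv Md0.
set e := Num.truncn (M%:R * delta) in e1 e2.
have eP m : m%:R <= M%:R * delta -> (m <= e)%N.
  by move=> h; rewrite -ltnS -(ltr_nat R); apply: le_lt_trans e2.
have eM : (e < M)%N.
  by rewrite -(ltr_nat R); apply: le_lt_trans e1 _; rewrite gtr_pMr.
set A := [pred j | _].
pose sh (j : 'I_(6 * M)) := ((j + (6 * M - i) + e) %% (6 * M))%N.
have iN := ltn_ord i.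
have small (j : 'I_(6 * M)) : j \in A -> (sh j <= e.*2)%N.
  have jN := ltn_ord j; rewrite inE => close.
  have [ji|/ltnW ij] := leqP j i.
    have /close_roots6 : (j <= i < 6 * M)%N by rewrite ji.
    move=> /(_ _ d1 close) [|] /eP h; rewrite /sh.
      have -> : (j + (6 * M - i) + e = 6 * M + (e - (i - j)))%N by lia.
      by rewrite modnDl modn_small; lia.
    by rewrite modn_small; lia.
  have /close_roots6 : (i <= j < 6 * M)%N by rewrite ij.
  rewrite -normcN opprB in close.
  move=> /(_ _ d1 close) [|] /eP h; rewrite /sh.
    have -> : (j + (6 * M - i) + e = 6 * M + (e + (j - i)))%N by lia.
    by rewrite modnDl modn_small; lia.
  have -> : (j + (6 * M - i) + e = 6 * M + (6 * M + (e - (6 * M - (j - i)))))%N by lia.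
  by rewrite !modnDl modn_small; lia.
have shI : {in A &, injective (fun j => inord (sh j) : 'I_(e.*2).+1)}.
  move=> j j' Aj Aj' /(congr1 val); rewrite /= !inordK ?ltnS ?small // => /eqP.
  rewrite /sh !eqn_modDr !modn_small // => /eqP; exact: val_inj.
have : (#|A| <= (e.*2).+1)%N.
  by rewrite -(card_in_imset shI) (leq_trans (max_card _)) ?card_ord.
rewrite -(ler_nat R) -natr1 -mul2n natrM => h.
by apply: le_trans h _; rewrite lerD2r -mulrA ler_wpM2l.
Qed.

End RootsOfUnity.

Lemma sum_exprM_root (F : fieldType) (x : F) N : x ^+ N = 1 -> x != 1 ->
  \sum_(j < N) x ^+ j = 0.
Proof.
move=> xN x1; have := subrX1 x N; rewrite xN subrr => /esym/eqP.
by rewrite mulf_eq0 subr_eq0 (negPf x1) => /eqP.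
Qed.

Lemma prod_1D_expand (A : comNzRingType) n (z : 'I_n -> A) (t : A) :
  \prod_(i < n) (1 + t * z i) =
  \sum_(J : {set 'I_n}) t ^+ #|J| * \prod_(i in J) z i.
Proof.
under eq_bigr do rewrite addrC.
rewrite bigA_distr; apply: eq_bigr => J _.
by rewrite -big_mkcond /= big_split /= prodr_const.
Qed.

(** Cauchy's formula for the k-th coefficient, with the circle replaced by the
    N-th roots of unity; the exponent N - k stands for -k. *)
Lemma elem_sym_fourier (F : fieldType) n (z : 'I_n -> F) (k N : nat) (t w : F) :
  (k <= n)%N -> (n < N)%N -> N.-primitive_root w ->
  \sum_(j < N) w ^+ (j * (N - k)) * \prod_(i < n) (1 + t * w ^+ j * z i) =
  N%:R * t ^+ k * elem_sym z k.
Proof.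
move=> kn nN wP.
under eq_bigr do rewrite prod_1D_expand mulr_sumr.
rewrite exchange_big /= /elem_sym mulr_sumr [RHS]big_mkcond /=.
apply: eq_bigr => J _; have Jn : (#|J| <= n)%N by rewrite -[n in (_ <= n)%N]card_ord max_card.
transitivity ((\sum_(j < N) (w ^+ (N - k + #|J|)) ^+ j) *
    (t ^+ #|J| * \prod_(i in J) z i)).
  rewrite mulr_suml; apply: eq_bigr => j _.
  rewrite exprMn -!exprM [(j * _)%N]mulnC [(j * _)%N]mulnC mulnDl exprD; ring.
have [->|Jk] := eqVneq #|J| k.
  rewrite subnK ?(leq_trans kn) 1?ltnW // (prim_expr_order wP).
  have -> : \sum_(j < N) (1 : F) ^+ j = N%:R.
    by rewrite -[in RHS](card_ord N) -sumr_const; apply: eq_bigr => j _; rewrite expr1n.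
  by rewrite mulrA.
rewrite sum_exprM_root ?mul0r //.
  by rewrite -exprM mulnC exprM (prim_expr_order wP) expr1n.
rewrite -(prim_order_dvd wP); apply/negP => /dvdnP [q qE].
have : (q = 1)%N \/ (q = 0)%N \/ (q >= 2)%N by lia.
by case=> [q1|[q0|q2]]; [move: qE; rewrite q1; lia | move: qE; rewrite q0; lia | nia].
Qed.

Lemma root6_primitive (R : realType) (M : nat) : (0 < M)%N ->
  (6 * M)%N.-primitive_root (root6 R M 1).
Proof.
move=> M0; have pi0 := pi_gt0 R.
have N0 : (0 < 6 * M)%N by rewrite muln_gt0.
have NR : 0 < (6 * M)%:R :> R by rewrite ltr0n.
have pw j : root6 R M 1 ^+ j = root6 R M j by rewrite /root6 mulr1n cisMn.
have root0 : root6 R M 0 = 1 by rewrite /root6 mulr0n /cis cos0 sin0.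
apply/andP; split => //; apply/forallP => i; apply/eqP.
rewrite unity_rootE pw.
have [->|iN] := eqVneq i.+1 (6 * M)%N.
  have -> : root6 R M (6 * M) = cis (pi *+ 2).
    by rewrite /root6 -[X in cis X]mulr_natr divfK ?gt_eqF //; congr cis; ring.
  by rewrite /cis cos2pi sin2pi eqxx.
have {}iN : (i.+1 < 6 * M)%N by rewrite ltn_neqAle iN ltn_ord.
apply/negbTE/eqP; rewrite -root0 => e.
have : normc (root6 R M i.+1 - root6 R M 0) = 0.
  by rewrite e subrr ComplexField.Normc.normc0.
rewrite normc_root6_sub ?(ltnW iN) // subn0 => /eqP; rewrite mulf_eq0 pnatr_eq0 /=.
rewrite gt_eqF //; apply: sin_gt0_pi; rewrite mulrn_wgt0 ?divr_gt0 //=.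
by rewrite -mulr_natr mulrAC ltr_pdivrMr // ltr_pM2l // ltr_nat.
Qed.

(** * Bounding the coefficients *)

Section Defect.
Variables (R : realType) (n : nat) (z : 'I_n -> R[i]) (r : R).
Hypotheses (n0 : (0 < n)%N) (r0 : 0 < r).
Hypotheses (sum_z : \sum_i z i = 0) (sum_z2 : \sum_i normc (z i) ^+ 2 = n%:R).

Let s := Num.sqrt (1 + r ^+ 2).

Definition scaled_factor (p : R[i]) i := normc (1 + r%:C * p * z i) / s.
(** The loss in the arithmetic-geometric mean inequality for the factors of the
    product at the point r p, whose mean square is 1 by
    [sum_sqr_scaled_factor]. *)
Definition defect (p : R[i]) := \sum_i (scaled_factor p i - 1) ^+ 2.

Let s2 : s ^+ 2 = 1 + r ^+ 2.
Proof. by rewrite sqr_sqrtr // addr_ge0 ?sqr_ge0. Qed.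

Let s0 : 0 < s.
Proof. by rewrite sqrtr_gt0 ltr_wpDr ?sqr_ge0. Qed.

Lemma defect_ge0 p : 0 <= defect p.
Proof. by apply: sumr_ge0 => i _; apply: sqr_ge0. Qed.

(** The linear terms cancel because the z_i sum to 0. *)
Lemma sum_sqr_scaled_factor p : normc p = 1 ->
  \sum_i scaled_factor p i ^+ 2 = n%:R.
Proof.
move=> p1; rewrite /scaled_factor.
under eq_bigr do rewrite exprMn exprVn.
rewrite -mulr_suml s2.
have -> : \sum_i normc (1 + r%:C * p * z i) ^+ 2 =
    \sum_(i < n) 1 + r ^+ 2 * (\sum_i normc (z i) ^+ 2)
      + 2 * r * Re (p * \sum_i z i).
  rewrite [p * _]mulr_sumr (big_morph (@Re R) (id1 := 0) (op1 := +%R));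
    [|by case=> [? ?] [? ?]|by []].
  rewrite !mulr_sumr -!big_split /=.
  apply: eq_bigr => i _.
  have -> : r ^+ 2 * normc (z i) ^+ 2 = r ^+ 2 * normc p ^+ 2 * normc (z i) ^+ 2.
    by rewrite p1 expr1n mulr1.
  by rewrite !sqr_normcE; case: (p) (z i) => [a b] [c d] /=; ring.
rewrite sum_z mulr0 /= mulr0 addr0 sum_z2 sumr_const card_ord.
have : 0 < 1 + r ^+ 2 by rewrite -s2 exprn_gt0.
by move=> h; field; rewrite gt_eqF.
Qed.

Lemma normc_prod_le p : normc p = 1 ->
  normc (\prod_i (1 + r%:C * p * z i)) <= s ^+ n * expR (- defect p / 2).
Proof.
move=> p1.
rewrite normc_prod.
have -> : \prod_i normc (1 + r%:C * p * z i) = s ^+ n * \prod_i scaled_factor p i.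
  rewrite -[n in s ^+ n]card_ord -prodr_const -big_split /=.
  by apply: eq_bigr => i _; rewrite /scaled_factor [RHS]mulrC divfK // gt_eqF.
rewrite ler_wpM2l ?exprn_ge0 ?(ltW s0) // AGM_defect ?sum_sqr_scaled_factor //.
by move=> i; rewrite divr_ge0 ?normc_ge0 // ltW.
Qed.

Lemma defect_three_points (d : R) u v w : 0 <= d <= 1 ->
  normc u = 1 -> normc v = 1 -> normc w = 1 ->
  d <= normc (u - v) -> d <= normc (v - w) -> d <= normc (w - u) ->
  3 * d ^+ 4 * (r ^+ 2 * n%:R) <= 64 * s ^+ 4 * (defect u + defect v + defect w).
Proof.
move=> d01 u1 v1 w1 uv vw wu.
rewrite -sum_z2 /defect -!big_split /= !mulr_sumr; apply: ler_sum => i _.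
by rewrite -exprMn; apply: (three_point_defect (z i) (ltW r0)).
Qed.

(** In the notation of the introduction the condition reads
    D <= d^4 K / 64, as r^2 n = (1 + r^2)^2 K.  If u is such a point, and v
    another one at distance more than d from u, then by [defect_three_points]
    every further one is within d of u or of v. *)
Lemma card_small_defect (M : nat) (d : R) : (0 < M)%N -> 0 <= d < 1 ->
  #|[pred j : 'I_(6 * M) |
      64 * s ^+ 4 * defect (root6 R M j) <= d ^+ 4 * (r ^+ 2 * n%:R)]|%:R
    <= 4 * M%:R * d + 2.
Proof.
move=> M0 /andP[d0 d1]; set A := [pred j | _].
have MR : 0 < M%:R :> R by rewrite ltr0n.
have Md : 0 <= M%:R * d by rewrite mulr_ge0 // ltW.
have [u Au|A0] := pickP A; last first.
  by rewrite (eq_card0 A0); lra.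
pose ball (u : 'I_(6 * M)) :=
  [set j : 'I_(6 * M) | normc (root6 R M u - root6 R M j) <= d].
have cball i : #|ball i|%:R <= 2 * M%:R * d + 1.
  by rewrite cardsE card_close_roots6 // d0.
have [Au'|] := boolP (A \subset ball u).
  have : #|A|%:R <= #|ball u|%:R :> R by rewrite ler_nat subset_leq_card.
  by have := cball u; lra.
case/subsetPn => v Av; rewrite inE -ltNge => uv.
have sub : A \subset ball u :|: ball v.
  apply/subsetP => w Aw; rewrite !inE; apply/orP.
  have [|wu] := leP (normc (root6 R M u - root6 R M w)) d; first by left.
  have [|wv] := leP (normc (root6 R M v - root6 R M w)) d; first by right.
  (* The least of the three distances exceeds d strictly, which makes the
     bounds on the three defects contradictory. *)
  pose d' := Num.min 1 (Num.min (normc (root6 R M u - root6 R M v))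
    (Num.min (normc (root6 R M v - root6 R M w)) (normc (root6 R M u - root6 R M w)))).
  have dd' : d < d' by rewrite !lt_min d1 uv wu wv.
  have := @defect_three_points d' (root6 R M u) (root6 R M v) (root6 R M w).
  rewrite -[normc (root6 R M w - _)]normcN opprB !normc_cis !ge_min !lexx ?orbT /=.
  rewrite (le_trans d0 (ltW dd')) => /(_ isT erefl erefl erefl isT isT isT).
  move: Au Av Aw; rewrite !inE => hu hv hw h.
  have : d' ^+ 4 * (r ^+ 2 * n%:R) <= d ^+ 4 * (r ^+ 2 * n%:R) by lra.
  have rn : 0 < r ^+ 2 * n%:R by rewrite mulr_gt0 ?exprn_gt0 ?ltr0n.
  have d4 : d ^+ 4 < d' ^+ 4 by rewrite ltrXn2r ?nnegrE // (le_trans d0 (ltW dd')).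
  by rewrite ler_pM2r // leNgt d4.
have : #|A|%:R <= #|ball u|%:R + #|ball v|%:R :> R.
  by rewrite -natrD ler_nat (leq_trans (subset_leq_card sub)) // cardsU leq_subr.
by have := cball u; have := cball v; lra.
Qed.

(** The hypothesis on beta is beta^4 = 64/K in the notation of the introduction. *)
Lemma sum_expR_defect (M : nat) (beta : R) : (0 < M)%N -> 0 < beta < 1 ->
  beta ^+ 4 * (r ^+ 2 * n%:R) = 64 * s ^+ 4 ->
  \sum_(j < 6 * M) expR (- defect (root6 R M j) / 2) <= (6 * M)%:R * beta + 3.
Proof.
move=> M0 /andP[b0 b1] bE.
have rn : 0 < r ^+ 2 * n%:R by rewrite mulr_gt0 ?exprn_gt0 ?ltr0n.
have b4 : 0 < beta ^+ 4 by rewrite exprn_gt0.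
apply: (@sum_le_of_sublevel_count _ M
  (fun j => beta ^+ 4 * defect (root6 R M j))) => //.
- by rewrite b0.
- by move=> j; rewrite mulr_ge0 ?defect_ge0 // ltW.
- by move=> j; rewrite expRN_half_le1 ?defect_ge0.
- by move=> j; rewrite mulrCA ler_piMr ?(ltW b4) // expRN_half_mul_le1 ?defect_ge0.
move=> d d01; have := card_small_defect M0 d01.
rewrite (eq_card (_ : _ =i [pred j : 'I_(6 * M) |
  beta ^+ 4 * defect (root6 R M j) <= d ^+ 4])) // => j.
by rewrite !inE -bE [_ * (r ^+ 2 * _) * _]mulrAC ler_pM2r.
Qed.

Lemma elem_sym_le_sum (k M : nat) : (k <= n)%N -> (n < 6 * M)%N ->
  (6 * M)%:R * r ^+ k * normc (elem_sym z k) <=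
  s ^+ n * \sum_(j < 6 * M) expR (- defect (root6 R M j) / 2).
Proof.
move=> kn nM; have M0 : (0 < M)%N by lia.
have pw j : root6 R M 1 ^+ j = root6 R M j by rewrite /root6 mulr1n cisMn.
have := elem_sym_fourier z r%:C kn nM (root6_primitive R M0).
move/(congr1 (@normc R)); rewrite !ComplexField.Normc.normcM.
have -> : normc (r%:C ^+ k) = r ^+ k.
  by rewrite -rmorphXn normc_real ger0_norm // exprn_ge0 // ltW.
have -> : normc ((6 * M)%:R : R[i]) = (6 * M)%:R.
  by rewrite -[(6 * M)%:R](rmorph_nat (real_complex R)) normc_real normr_nat.
move=> <-; rewrite mulr_sumr.
apply: le_trans (normc_sum _) _; apply: ler_sum => j _.
rewrite ComplexField.Normc.normcM exprM pw.
have -> : normc (root6 R M j ^+ (6 * M - k)) = 1.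
  by rewrite /root6 -cisMn normc_cis.
by rewrite mul1r normc_prod_le // normc_cis.
Qed.

End Defect.

Lemma elem_sym0 (A : comNzRingType) n (z : 'I_n -> A) : elem_sym z 0 = 1.
Proof.
rewrite /elem_sym (big_pred1 set0) ?big_set0 // => J.
by rewrite cards_eq0.
Qed.

Lemma elem_symn (A : comNzRingType) n (z : 'I_n -> A) : elem_sym z n = \prod_i z i.
Proof.
rewrite /elem_sym (big_pred1 setT) => [|J].
  by apply: eq_bigl => i; rewrite inE.
apply/eqP/eqP => [Jn|->]; last by rewrite cardsT card_ord.
by apply/eqP; rewrite eqEcard subsetT cardsT card_ord Jn leqnn.
Qed.

Lemma normc_prod_le1 (R : realType) n (z : 'I_n -> R[i]) : (0 < n)%N ->
  \sum_i normc (z i) ^+ 2 = n%:R -> normc (\prod_i z i) <= 1.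
Proof.
move=> n0 sz.
rewrite normc_prod; apply: le_trans (AGM_defect n0 _ sz) _; first by move=> i; apply: normc_ge0.
by rewrite expRN_half_le1 ?sumr_ge0 // => i _; apply: sqr_ge0.
Qed.

Lemma elem_sym_bound_sqr (R : realType) n k (z : 'I_n -> R[i]) :
  (0 < n)%N -> (k <= n)%N -> \sum_i z i = 0 ->
  \sum_i normc (z i) ^+ 2 = n%:R ->
  normc (elem_sym z k) ^+ 2 <= 24 * 'C(n, k)%:R.
Proof.
move=> n0 kn sz sz2.
have [->|k0] := posnP k.
  by rewrite elem_sym0 bin0 ComplexField.Normc.normc1; lra.
move: kn; rewrite leq_eqVlt => /orP[/eqP ->|kn].
  rewrite elem_symn binn; have := normc_prod_le1 n0 sz2.
  have := normc_ge0 (\prod_i z i); nra.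
pose m := (n - k)%N; have m0 : (0 < m)%N by rewrite subn_gt0.
have nE : n = (k + m)%N by rewrite subnKC // ltnW.
have kR : 0 < k%:R :> R by rewrite ltr0n.
have mR : 0 < m%:R :> R by rewrite ltr0n.
have nR : 0 < n%:R :> R by rewrite ltr0n.
have nER : n%:R = k%:R + m%:R :> R by rewrite -natrD -nE.
pose r : R := Num.sqrt (k%:R / m%:R).
have r2 : r ^+ 2 = k%:R / m%:R by rewrite sqr_sqrtr // divr_ge0 // ltW.
have r0 : 0 < r by rewrite sqrtr_gt0 divr_gt0.
pose s : R := Num.sqrt (1 + r ^+ 2).
have s2 : s ^+ 2 = n%:R / m%:R.
  rewrite sqr_sqrtr ?addr_ge0 ?sqr_ge0 // r2 nER; field; rewrite gt_eqF //.
have s0 : 0 < s by rewrite sqrtr_gt0 ltr_wpDr ?sqr_ge0.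
pose e := normc (elem_sym z k); rewrite -/e.
have e0 : 0 <= e by apply: normc_ge0.
pose avg M : R := (\sum_(j < 6 * M) expR (- defect z r (root6 R M j) / 2)) / (6 * M)%:R.
pose H : R := (s ^+ 2) ^+ n / (r ^+ 2) ^+ k.
have H0 : 0 <= H by rewrite divr_ge0 // !exprn_ge0 // ltW.
have avg0 M : 0 <= avg M.
  by rewrite divr_ge0 ?ler0n // sumr_ge0 // => j _; apply: expR_ge0.
have eH M : (n < M)%N -> e ^+ 2 <= H * avg M ^+ 2.
  move=> nM; have MR : 0 < (6 * M)%:R :> R by rewrite ltr0n; lia.
  have := @elem_sym_le_sum R n z r n0 r0 sz sz2 k M (ltnW kn).
  rewrite -/s -/e => /(_ (leq_trans nM (leq_pmull M (isT : 0 < 6)%N))) h.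
  have rk : 0 < r ^+ k by rewrite exprn_gt0.
  have {h} h : e <= s ^+ n / r ^+ k * avg M.
    rewrite /avg mulrACA -invfM ler_pdivlMr ?mulr_gt0 // mulrC.
    by apply: le_trans h; rewrite [r ^+ k * _]mulrC.
  have -> : H * avg M ^+ 2 = (s ^+ n / r ^+ k * avg M) ^+ 2.
    by rewrite /H -!exprM ![(2 * _)%N]mulnC !exprM [RHS]exprMn; congr (_ * _); rewrite expr_div_n.
  by rewrite ler_sqr ?nnegrE // (le_trans e0 h).
pose K : R := k%:R * m%:R / n%:R.
have K0 : 0 < K by rewrite divr_gt0 ?mulr_gt0.
have HK : H ^+ 2 <= 8 * K * 'C(n, k)%:R ^+ 2.
  have := @bin_entropy_lower R k m k0 m0; rewrite -nE => bnd.
  have km0 : 0 < k%:R ^+ k.*2 * m%:R ^+ m.*2 * n%:R :> R.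
    by rewrite !mulr_gt0 // exprn_gt0.
  rewrite -(ler_pM2r km0).
  have -> : H ^+ 2 * (k%:R ^+ k.*2 * m%:R ^+ m.*2 * n%:R) = n%:R ^+ n.*2.+1.
    rewrite /H s2 r2 !expr_div_n -!exprM !muln2.
    have -> : n.*2 = (k.*2 + m.*2)%N by rewrite nE; lia.
    rewrite exprS !exprD; field.
    by rewrite !expf_neq0 // gt_eqF.
  apply: le_trans bnd _; rewrite /K le_eqVlt; apply/orP; left; apply/eqP.
  by rewrite !exprS; field; rewrite gt_eqF.
have C0 : 0 <= 'C(n, k)%:R :> R by rewrite ler0n.
have [beta b0 bE] := exists_fourth_root (divr_ge0 (ler0n R 64) (ltW K0)).
have bK : beta ^+ 4 * K = 64 by rewrite -bE divfK // gt_eqF.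
have {}b0 : 0 < beta.
  rewrite lt_neqAle b0 andbT; apply/eqP => bb; move: bK; rewrite -bb expr0n mul0r; lra.
suff [M nM avgM] : exists2 M, (n < M)%N & 8 * K * avg M ^+ 4 <= 24 ^+ 2.
  apply: le_trans (eH M nM) _.
  have lhs0 : 0 <= H * avg M ^+ 2 := mulr_ge0 H0 (sqr_ge0 _).
  have rhs0 : 0 <= 24 * 'C(n, k)%:R :> R by rewrite mulr_ge0.
  rewrite -ler_sqr ?nnegrE //.
  rewrite exprMn -exprM [leRHS]exprMn.
  apply: le_trans (ler_wpM2r _ HK) _; first by rewrite exprn_ge0.
  by rewrite mulrAC ler_wpM2r // exprn_ge0.
have avg1 M : (n < M)%N -> avg M <= 1.
  move=> nM; have MR : 0 < (6 * M)%:R :> R by rewrite ltr0n; lia.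
  rewrite /avg ler_pdivrMr // mul1r.
  apply: le_trans (_ : \sum_(j < 6 * M) 1 <= _).
    by apply: ler_sum => j _; rewrite expRN_half_le1 ?defect_ge0.
  by rewrite sumr_const card_ord.
(* For K <= 72 the trivial bound 1 on the mean already gives 24^2 = 8 * 72. *)
have [K72|K72] := leP K 72.
  exists n.+1 => //.
  have : avg n.+1 ^+ 4 <= 1 by rewrite exprn_ile1 ?avg1.
  have : 0 <= avg n.+1 ^+ 4 by rewrite exprn_ge0.
  set a := avg _ ^+ 4 => a0 a1.
  have : K * a <= 72 * 1 by rewrite ler_pM // ltW.
  rewrite -mulrA; lra.
have b1 : beta < 1.
  rewrite ltNge; apply/negP => /(exprn_ege1 4) b1.
  have := ler_wpM2r (ltW K0) b1; lra.
(* With M beta >= 25 the error term 3 is at most 6M beta / 50, and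
   512 * (102/100)^4 <= 24^2. *)
exists (n + Num.truncn (25 / beta)).+1; first by rewrite ltnS leq_addr.
set M := (_ + _).+1.
have M0 : (0 < M)%N by [].
have MR : 0 < M%:R :> R by rewrite ltr0n.
have Mb : 25 <= M%:R * beta.
  rewrite -ler_pdivrMr //; apply: ltW.
  have /andP[_ h] := truncn_itv (divr_ge0 (ler0n R 25) (ltW b0)).
  by apply: lt_le_trans h _; rewrite ler_nat ltnS leq_addl.
have avgb : avg M <= 102 / 100 * beta.
  have key : beta ^+ 4 * (r ^+ 2 * n%:R) = 64 * s ^+ 4.
    rewrite -bK (exprM s 2 2) s2 r2 /K; field; rewrite !gt_eqF //.
  have := @sum_expR_defect R n z r n0 r0 sz2 M beta M0 _ key.
  rewrite b0 b1 => /(_ isT) h.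
  rewrite /avg ler_pdivrMr ?ltr0n ?muln_gt0 //; apply: le_trans h _.
  rewrite natrM; lra.
have : avg M ^+ 4 <= (102 / 100 * beta) ^+ 4.
  have b0' : 0 <= 102 / 100 * beta by lra.
  by rewrite lerXn2r ?nnegrE.
rewrite [leRHS]exprMn => h4.
have := ler_wpM2l (ltW K0) h4.
rewrite [leRHS]mulrCA [K * beta ^+ 4]mulrC bK -mulrA; lra.
Qed.

Theorem theorem1p1 (R : realType) :
  (exists C : R, 0 < C /\ elem_sym_bound C) /\ elem_sym_bound (24%:R : R).
Proof.
suff main : elem_sym_bound (24%:R : R) by split; first by exists 24%:R.
move=> n k z n0 kn sz sz2.
have sz2' : \sum_i normc (z i) ^+ 2 = n%:R.
  apply: (@complexI R); rewrite rmorph_nat -sz2 rmorph_sum /=.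
  by apply: eq_bigr => i _; rewrite normcP rmorphXn.
rewrite normcP lecR -[normc _]ger0_norm ?normc_ge0 // -sqrtr_sqr.
by rewrite ler_wsqrtr // elem_sym_bound_sqr.
Qed.
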